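(* Let $I\subset R=\mathbb{K}[x_1,\ldots,x_n]$ be a monomial ideal minimally generated by monomials $f_1,\ldots,f_m$, and let $d_k=\deg(f_k)$ for $k=1,\ldots,m$. Suppose that for each $k=2,\ldots,m$ the colon ideal $(f_1,\ldots,f_{k-1}):f_k$ is generated by an $(a_k,1)$-regular sequence, i.e. by a single monomial of degree $a_k$. Set $r_k=1$ for $k=2,\ldots,m$ and $a_1=r_1=0$, and for $i,j\ge0$ let $K^i_j=\{1\le k\le m: a_ki+d_k=j\}$. Then for all $i,j\ge 0$, $$\beta_{i,j}(I)=\sum_{k\in K^i_j}\binom{r_k}{i}.$$
   Context: $\mathbb{K}$ is a field and $R=\mathbb{K}[x_1,\ldots,x_n]$ is the standard graded polynomial ring; $\beta_{i,j}(M)=\dim_{\mathbb{K}}\mathrm{Tor}_i^R(M,\mathbb{K})_j$. Binomial coefficients $\binom{r}{i}$ are $0$ for $i>r$, $\binom{0}{0}=1$, and an empty sum is $0$. *)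

(* Defs.v *)
From mathcomp Require Import all_boot all_order all_algebra.
From mathcomp Require Import mpoly.

Set Implicit Arguments.
Unset Strict Implicit.
Unset Printing Implicit Defensive.

Import GRing.Theory.

Local Open Scope ring_scope.

Section Ideals.
Variables (K : fieldType) (n : nat).
Implicit Types (I J : {mpoly K[n]} -> Prop) (p q : {mpoly K[n]}).

Definition ideal_gen (T : finType) (P : pred T) (g : T -> {mpoly K[n]}) :
    {mpoly K[n]} -> Prop :=
  fun p => exists c : T -> {mpoly K[n]}, p = \sum_(t | P t) c t * g t.

Definition principal q : {mpoly K[n]} -> Prop :=
  fun p => exists c, p = c * q.

Definition colon J q : {mpoly K[n]} -> Prop := fun p => J (p * q).

Definition same_ideal I J : Prop := forall p, I p <-> J p.

(* No generator lies in the ideal generated by the other ones. *)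
Definition minimally_generates (T : finType) (g : T -> {mpoly K[n]}) I : Prop :=
  same_ideal I (ideal_gen predT g) /\
  forall t, ~ ideal_gen (predC1 t) g (g t).

End Ideals.

Section BettiNumbers.
Variables (K : fieldType) (n : nat).

(* [zhomog z p]: p is zero or homogeneous of degree z, where z may be
   negative (and then p is zero). *)
Definition zhomog (z : int) (p : {mpoly K[n]}) : bool :=
  if z is Posz e then p \is e.-homog else p == 0.

(* A sequence ... -> F_1 -> F_0 -> R of finite free modules.  Elements of F_i
   are row vectors and maps act by right multiplication: [gf_diff i] is the map
   F_(i+1) -> F_i and [gf_aug] the map F_0 -> R.  The k-th basis vector of F_i
   has degree [gf_deg k], i.e. F_i is the direct sum of the R(- gf_deg k). *)
Record graded_free_seq := GradedFreeSeq {
  gf_rank : nat -> nat;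
  gf_deg  : forall i, 'I_(gf_rank i) -> int;
  gf_diff : forall i, 'M[{mpoly K[n]}]_(gf_rank i.+1, gf_rank i);
  gf_aug  : 'cV[{mpoly K[n]}]_(gf_rank 0)
}.

(* F is a graded free resolution of the ideal I: its maps are homogeneous of
   degree 0, and ... -> F_1 -> F_0 -> I -> 0 is exact. *)
Definition graded_free_resolution (F : graded_free_seq)
    (I : {mpoly K[n]} -> Prop) : Prop :=
  [/\ forall i k l, zhomog (gf_deg k - gf_deg l) (gf_diff F i k l),
      forall k, zhomog (gf_deg k) (gf_aug F k 0),
      forall p, I p <-> exists v : 'rV_(gf_rank F 0), p = (v *m gf_aug F) 0 0,
      forall v : 'rV_(gf_rank F 0),
        v *m gf_aug F = 0 <-> exists w, v = w *m gf_diff F 0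
    & forall i (v : 'rV_(gf_rank F i.+1)),
        v *m gf_diff F i = 0 <-> exists w, v = w *m gf_diff F i.+1].

Section TorDimension.
Variable F : graded_free_seq.

(* K is R modulo the variables, so the tensor product of F_i with K is
   K^(rank F_i), and the induced differential is the matrix of the constant
   terms. *)
Definition tensK_diff i : 'M[K]_(gf_rank F i.+1, gf_rank F i) :=
  map_mx (mcoeff 0%MM) (gf_diff F i).

(* The row space of this matrix is the degree j component of the tensor product
   of F_i with K, spanned by the basis vectors of degree j. *)
Definition tensK_part i (j : int) : 'M[K]_(gf_rank F i) :=
  diag_mx (\row_k (gf_deg k == j)%:R).

Definition tensK_cycles i (j : int) : 'M[K]_(gf_rank F i) :=
  match i with
  | 0 => tensK_part 0 j
  | i'.+1 => (tensK_part i'.+1 j :&: kermx (tensK_diff i'))%MS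
  end.

Definition tensK_boundaries i (j : int) : 'M[K]_(gf_rank F i.+1, gf_rank F i) :=
  tensK_part i.+1 j *m tensK_diff i.

(* The dimension of the degree j component of the i-th homology; boundaries are
   cycles when F is a resolution, so the subtraction does not truncate. *)
Definition tor_dim i (j : int) : nat :=
  (\rank (tensK_cycles i j) - \rank (tensK_boundaries i j))%N.

End TorDimension.

(* [has_betti I i j b]: the K-dimension of Tor_i^R(I, K)_j is well defined and
   equal to b: I has a graded free resolution by modules of finite rank, and
   every such resolution gives the value b. *)
Definition has_betti (I : {mpoly K[n]} -> Prop) (i : nat) (j : int) (b : nat) :
    Prop :=
  (exists F, graded_free_resolution F I) /\
  forall F, graded_free_resolution F I -> tor_dim F i j = b.

End BettiNumbers.

(* The index set K^i_j. *)
Definition index_set (m : nat) (a d : 'I_m -> nat) (i j : nat) : {set 'I_m} :=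
  [set k : 'I_m | a k * i + d k == j]%N.

(* Main.v *)
Require Import Defs.
From mathcomp Require Import all_boot all_order all_algebra.
From mathcomp Require Import mpoly.
From Stdlib Require Import ClassicalEpsilon.

(** Because each colon ideal (f_1, ..., f_(k-1)) : f_k is generated by a single
    monomial X^(u_k), the relations between the generators are obtained one
    generator at a time: X^(u_k) f_k is a multiple X^(w_k) f_t of an earlier
    generator, and the m - 1 relations X^(u_k) e_k - X^(w_k) e_t generate all
    relations ([syz_exact]).  Their matrix is triangular with nonzero diagonal,
    so they are independent ([syz_inj]), and 0 -> R^(m-1) -> R^m -> I -> 0 is a
    graded free resolution ([quot_seq_resolution]).  The basis element of R^m
    with index k has degree d_k, and the relation with index k has degree
    a_k + d_k.  The generators being minimal, no X^(u_k) or X^(w_k) is 1, so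
    the resolution is minimal ([quot_seq_minimal]) and its Tor dimensions are
    numbers of basis elements ([tor_dim_minimal]), which is the formula.

    These numbers are the Betti numbers only if every graded free resolution of
    I gives the same ones ([tor_dim_unique]).  This is the comparison theorem:
    the identity of I lifts to graded chain maps in both directions
    ([comparisonP]), whose composite is homotopic to the identity
    ([homotopyP]).  Reducing modulo the variables and restricting to one degree
    turns this into the rank inequality of [rank_quotient_le], used in both
    directions. *)

Import GRing.Theory.
Local Open Scope ring_scope.

Set Implicit Arguments.
Unset Strict Implicit.
Unset Printing Implicit Defensive.

(** * Homogeneous components and graded matrices *)

Section Grading.
Variables (K : fieldType) (n : nat).
Implicit Types (p q : {mpoly K[n]}) (z w : int) (u : 'X_{1..n}).

Lemma zhomogP z p :
  reflect (forall u, p@_u != 0 -> (mdeg u)%:Z = z) (zhomog z p).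
Proof.
apply: (iffP idP).
  case: z => [e /dhomogP hp u|e /eqP-> u]; last by rewrite mcoeff0 eqxx.
  by rewrite -mcoeff_msupp => /hp /= ->.
case: z => [e|e] hp /=.
  by apply/dhomogP => u; rewrite mcoeff_msupp => /hp [].
by apply/eqP/mpolyP => u; rewrite mcoeff0; apply/eqP/negPn/negP => /hp.
Qed.

(** The integer-indexed version of the component [pihomog mdeg]; it vanishes
    for z < 0. *)
Definition zpart z p : {mpoly K[n]} :=
  \sum_(u <- msupp p | (mdeg u)%:Z == z) p@_u *: 'X_[u].

Lemma mcoeff_zpart z p u :
  (zpart z p)@_u = if (mdeg u)%:Z == z then p@_u else 0.
Proof.
rewrite /zpart raddf_sum /=.
under eq_bigr do rewrite mcoeffZ mcoeffX.
have [u_p|u_p] := boolP (u \in msupp p); last first.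
  rewrite big_seq_cond big1 => [|v /andP[v_p _]]; last first.
    by case: eqP v_p => [->|]; rewrite ?mulr0 ?(negPf u_p).
  by rewrite (memN_msupp_eq0 u_p) if_same.
rewrite big_mkcond (bigD1_seq u) ?msupp_uniq //= eqxx mulr1 big1 ?addr0 //.
by move=> v /negPf->; rewrite mulr0 if_same.
Qed.

Lemma zpart_homog z p : zhomog z (zpart z p).
Proof.
by apply/zhomogP => u; rewrite mcoeff_zpart; case: ifP => [/eqP|_ /eqP].
Qed.

Lemma zpart_id z p : zhomog z p -> zpart z p = p.
Proof.
move=> /zhomogP hp; apply/mpolyP => u; rewrite mcoeff_zpart.
by have [/eqP->|/hp->] := boolP (p@_u == 0); rewrite ?if_same ?eqxx.
Qed.

Lemma zpartM z w p q :
  zhomog w q -> zpart z (p * q) = zpart (z - w) p * q.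
Proof.
move=> /zhomogP hq; apply/mpolyP => u; rewrite mcoeff_zpart.
rewrite !(mcoeffM _ _ u).
set zu := (_ == z); transitivity
  (\sum_(k : 'X_{1..n < (mdeg u).+1, (mdeg u).+1} | u == (k.1 + k.2)%MM)
     if zu then p@_k.1 * q@_k.2 else 0).
  by case: zu => //; rewrite big1.
apply: eq_bigr => k /eqP uE; rewrite mcoeff_zpart.
have [->|/hq k2w] := eqVneq q@_k.2 0; first by rewrite !mulr0 if_same.
have ->: zu = ((mdeg k.1)%:Z == z - w).
  by rewrite /zu {1}uE mdegD PoszD k2w eq_sym -subr_eq eq_sym.
by case: ifP => // _; rewrite mul0r.
Qed.

Lemma zpart_sum z (T : finType) (F : T -> {mpoly K[n]}) :
  zpart z (\sum_t F t) = \sum_t zpart z (F t).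
Proof.
apply/mpolyP => u; rewrite mcoeff_zpart !(raddf_sum (mcoeff u)) /=.
case: ifP => zu; [apply: eq_bigr|rewrite big1 //] => t _;
  by rewrite mcoeff_zpart zu.
Qed.

Lemma zhomog0 z : zhomog z (0 : {mpoly K[n]}).
Proof. by apply/zhomogP => u; rewrite mcoeff0 eqxx. Qed.

Lemma zhomogD z p q : zhomog z p -> zhomog z q -> zhomog z (p + q).
Proof.
move=> /zhomogP hp /zhomogP hq; apply/zhomogP => u; rewrite mcoeffD.
have [->|/hp//] := eqVneq p@_u 0; have [->|/hq//] := eqVneq q@_u 0.
by rewrite addr0 eqxx.
Qed.

Lemma zhomogB z p q : zhomog z p -> zhomog z q -> zhomog z (p - q).
Proof.
move=> /zhomogP hp /zhomogP hq; apply/zhomogP => u; rewrite mcoeffB.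
have [->|/hp//] := eqVneq p@_u 0; have [->|/hq//] := eqVneq q@_u 0.
by rewrite subrr eqxx.
Qed.

Lemma zhomogM z w p q : zhomog z p -> zhomog w q -> zhomog (z + w) (p * q).
Proof.
move=> hp hq; have := zpart_homog (z + w) (p * q).
by rewrite (zpartM _ _ hq) addrK zpart_id.
Qed.

(** A is a degree 0 map between the free modules with basis degrees a and b. *)
Definition graded s t (a : 'I_s -> int) (b : 'I_t -> int)
    (A : 'M[{mpoly K[n]}]_(s, t)) : Prop :=
  forall k l, zhomog (a k - b l) (A k l).

Lemma graded0 s t (a : 'I_s -> int) (b : 'I_t -> int) : graded a b 0.
Proof. by move=> k l; rewrite mxE zhomog0. Qed.

Lemma graded1 s (a : 'I_s -> int) : graded a a 1%:M.
Proof.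
move=> k l; rewrite mxE; case: eqP => [->|_]; last exact: zhomog0.
by rewrite subrr /= dhomog1.
Qed.

Lemma gradedB s t (a : 'I_s -> int) (b : 'I_t -> int) A B :
  graded a b A -> graded a b B -> graded a b (A - B).
Proof. by move=> hA hB k l; rewrite !mxE zhomogB. Qed.

Lemma gradedM s t v (a : 'I_s -> int) (b : 'I_t -> int) (c : 'I_v -> int) A B :
  graded a b A -> graded b c B -> graded a c (A *m B).
Proof.
move=> hA hB k l; rewrite mxE; elim/big_rec: _ => [|i p _ hp].
  exact: zhomog0.
apply: zhomogD hp; rewrite -[a k](subrK (b i)) -addrA; exact: zhomogM.
Qed.

(** Any lift becomes a graded one when each entry is replaced by its component
    of the required degree, because B is graded. *)
Lemma graded_lift s t v (a : 'I_s -> int) (b : 'I_t -> int) (c : 'I_v -> int)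
    (A : 'M[{mpoly K[n]}]_(s, v)) (B : 'M_(t, v)) :
    graded a c A -> graded b c B -> (forall k, exists x, row k A = x *m B) ->
  exists W, graded a b W /\ W *m B = A.
Proof.
move=> hA hB /fin_all_exists[x xE].
exists (\matrix_(k, l) zpart (a k - b l) (x k 0 l)); split.
  by move=> k l; rewrite mxE zpart_homog.
apply/matrixP => k l; have := congr1 (fun M : 'rV__ => M 0 l) (xE k).
rewrite !mxE => AE; rewrite -[RHS](zpart_id (hA k l)) AE zpart_sum.
apply: eq_bigr => i _; rewrite mxE (zpartM _ _ (hB i l)).
by rewrite opprB addrA subrK.
Qed.

(** Choosing the lift by [epsilon] lets chain maps and homotopies be defined by
    plain recursion on the homological degree. *)
Definition chosen_lift s t v (a : 'I_s -> int) (b : 'I_t -> int)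
    (A : 'M[{mpoly K[n]}]_(s, v)) (B : 'M_(t, v)) : 'M_(s, t) :=
  epsilon (inhabits 0) (fun W => graded a b W /\ W *m B = A).

Lemma chosen_liftP s t v a b (c : 'I_v -> int) A B
    (W := @chosen_lift s t v a b A B) :
    graded a c A -> graded b c B -> (forall k, exists x, row k A = x *m B) ->
  graded a b W /\ W *m B = A.
Proof. move=> hA hB AB.
exact: epsilon_spec (inhabits (0 : 'M_(s, t))) _ (graded_lift hA hB AB). Qed.

(** The functor that tensors with K = R / (x_1, ..., x_n), on maps of free
    modules. *)
Definition mod_vars s t : 'M[{mpoly K[n]}]_(s, t) -> 'M[K]_(s, t) :=
  map_mx (mcoeff 0%MM).

(** The projection of K^s onto its component of degree j; it is the matrix used
    by [tensK_part]. *)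
Definition deg_proj s (a : 'I_s -> int) (j : int) : 'M[K]_s :=
  diag_mx (\row_k (a k == j)%:R).

Lemma deg_proj_idem s (a : 'I_s -> int) j :
  deg_proj a j *m deg_proj a j = deg_proj a j.
Proof.
apply/matrixP => k l; rewrite mul_diag_mx !mxE.
by case: eqP; rewrite ?mul1r // mul0r mul0rn.
Qed.

(** An entry of degree a k - b l has a nonzero constant term only if
    a k = b l. *)
Lemma deg_projC s t (a : 'I_s -> int) (b : 'I_t -> int) A j :
    graded a b A ->
  deg_proj a j *m mod_vars A = mod_vars A *m deg_proj b j.
Proof.
move=> hA; apply/matrixP => k l; rewrite mul_diag_mx mul_mx_diag !mxE mulrC.
have [->|] := eqVneq ((A k l)@_0%MM) 0; first by rewrite !mul0r.
move=> /(zhomogP _ _ (hA k l)); rewrite mdeg0 => /esym/eqP.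
by rewrite subr_eq0 => /eqP->.
Qed.

End Grading.

(** The map f induces Z/(Z meet ker) -> Z'/B', and an element that f sends into
    B' lies in B, since f g is the identity on Z modulo B. *)
Lemma rank_quotient_le (K : fieldType) s s' t t' q q'
    (Z : 'M[K]_(t, s)) (B : 'M_(q, s)) (Z' : 'M_(t', s')) (B' : 'M_(q', s'))
    (f : 'M_(s, s')) (g : 'M_(s', s)) :
    (Z *m f <= Z')%MS -> (B' *m g <= B)%MS -> (B' <= Z')%MS ->
    (Z *m (f *m g - 1%:M) <= B)%MS ->
  (\rank Z - \rank B <= \rank Z' - \rank B')%N.
Proof.
move=> Zf B'g B'Z' fgB.
rewrite leq_subLR -(mxrank_mul_ker Z (f *m cokermx B')) addnC leq_add //.
  apply/mxrankS/rV_subP => v; rewrite sub_capmx => /andP[vZ].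
  move=> /sub_kermxP; rewrite mulmxA => /eqP vf.
  rewrite -[v]mulmx1 -[1%:M](subKr (f *m g)) mulmxBr mulmxA addmx_sub //.
    by apply: submx_trans B'g; rewrite submxMr // submxE vf.
  by rewrite eqmx_opp; apply: submx_trans fgB; rewrite submxMr.
rewrite mulmxA; apply: leq_trans (mxrankS (submxMr _ Zf)) _.
rewrite -(leq_add2r (\rank B')) subnK ?mxrankS //.
rewrite -(mxrank_mul_ker Z' (cokermx B')) leq_add2l mxrankS // sub_capmx B'Z'.
by apply/sub_kermxP/mulmx_coker.
Qed.

(** * Independence of the resolution *)

Section Comparison.
Variables (K : fieldType) (n : nat).
Implicit Types (F G : graded_free_seq K n) (I : {mpoly K[n]} -> Prop).

(** The augmented complex, with R in position 0 and F_i in position i + 1, so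
    that the augmentation and the differentials are treated alike. *)
Definition aug_rank F i := if i is i'.+1 then gf_rank F i' else 1%N.

Definition aug_deg F i : 'I_(aug_rank F i) -> int :=
  match i with 0 => fun=> 0 | i'.+1 => @gf_deg K n F i' end.

Definition aug_diff F i : 'M[{mpoly K[n]}]_(aug_rank F i.+1, aug_rank F i) :=
  match i with 0 => gf_aug F | i'.+1 => gf_diff F i' end.

Lemma aug_diff_graded F I i :
    graded_free_resolution F I ->
  graded (@aug_deg F i.+1) (@aug_deg F i) (aug_diff F i).
Proof.
case=> F_graded F_aug _ _ _; case: i => [|i] k l /=; last exact: F_graded.
by rewrite ord1 subr0; apply: F_aug.
Qed.

Lemma aug_exact F I i (v : 'rV_(aug_rank F i.+1)) :
    graded_free_resolution F I ->
  v *m aug_diff F i = 0 <-> exists w, v = w *m aug_diff F i.+1.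
Proof.
by case=> _ _ _ ex0 exS; case: i v => [|i] v; [apply: ex0|apply: exS].
Qed.

Lemma aug_diff_comp F I i :
  graded_free_resolution F I -> aug_diff F i.+1 *m aug_diff F i = 0.
Proof.
move=> resF; apply/row_matrixP => k; rewrite row_mul row0.
by apply/(aug_exact _ resF); exists (delta_mx 0 k); rewrite -rowE.
Qed.

Lemma rows_in_image F I i s (A : 'M_(s, _)) :
    graded_free_resolution F I -> A *m aug_diff F i = 0 ->
  forall k, exists w, row k A = w *m aug_diff F i.+1.
Proof.
by move=> resF A0 k; apply/(aug_exact _ resF); rewrite -row_mul A0 row0.
Qed.

(** A graded chain map F -> G that is the identity on R. *)
Fixpoint comparison F G i : 'M[{mpoly K[n]}]_(aug_rank F i, aug_rank G i) :=
  match i with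
  | 0 => 1%:M
  | i'.+1 => chosen_lift (@aug_deg F i'.+1) (@aug_deg G i'.+1)
               (aug_diff F i' *m comparison F G i') (aug_diff G i')
  end.

(** In position 0 the rows lift because both augmentations have image I; in
    higher positions they lift because they are cycles of G, which is exact. *)
Lemma comparisonP F G I i :
    graded_free_resolution F I -> graded_free_resolution G I ->
  [/\ graded (@aug_deg F i) (@aug_deg G i) (comparison F G i),
      graded (@aug_deg F i.+1) (@aug_deg G i.+1) (comparison F G i.+1)
    & comparison F G i.+1 *m aug_diff G i
        = aug_diff F i *m comparison F G i].
Proof.
move=> resF resG.
have step j : graded (@aug_deg F j) (@aug_deg G j) (comparison F G j) ->
    (forall k, exists w, row k (aug_diff F j *m comparison F G j)
                           = w *m aug_diff G j) ->
  graded (@aug_deg F j.+1) (@aug_deg G j.+1) (comparison F G j.+1) /\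
  comparison F G j.+1 *m aug_diff G j = aug_diff F j *m comparison F G j.
- move=> gr_j lift_j; apply: (chosen_liftP (c := @aug_deg G j)) => //.
    exact: gradedM (aug_diff_graded resF) gr_j.
  exact: aug_diff_graded resG.
elim: i => [|i [_ grS eqS]].
  have gr0 : graded (@aug_deg F 0) (@aug_deg G 0) (comparison F G 0).
    exact: graded1.
  have [|grS eqS] := step 0%N gr0; last by split.
  move=> k; case: resF resG => _ _ IF _ _ [_ _ IG _ _].
  have /IG[w wE] : I (gf_aug F k 0).
    by apply/IF; exists (delta_mx 0 k); rewrite -rowE mxE.
  by exists w; rewrite mulmx1; apply/rowP => l; rewrite ord1 -wE mxE.
have [|grSS eqSS] := step i.+1 grS; last by split.
apply: (rows_in_image resG).
by rewrite -mulmxA eqS mulmxA (aug_diff_comp _ resF) mul0mx.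
Qed.

(** The amount by which the round trip F -> G -> F fails to be the identity. *)
Definition comp_defect F G i :=
  comparison F G i *m comparison G F i - 1%:M.

(** A null-homotopy of [comp_defect]; it starts from 0 because the defect
    vanishes on R. *)
Fixpoint homotopy F G i : 'M[{mpoly K[n]}]_(aug_rank F i, aug_rank F i.+1) :=
  match i with
  | 0 => 0
  | i'.+1 => chosen_lift (@aug_deg F i'.+1) (@aug_deg F i'.+2)
      (comp_defect F G i'.+1 - aug_diff F i' *m homotopy F G i')
      (aug_diff F i'.+1)
  end.

(** The recursive step needs that defect - d h is a cycle, which follows from
    the homotopy identity one position below and d d = 0. *)
Lemma homotopyP F G I i :
    graded_free_resolution F I -> graded_free_resolution G I ->
  graded (@aug_deg F i.+1) (@aug_deg F i.+2) (homotopy F G i.+1) /\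
  comp_defect F G i.+1 = homotopy F G i.+1 *m aug_diff F i.+1
                         + aug_diff F i *m homotopy F G i.
Proof.
move=> resF resG.
have gr_defect j : graded (@aug_deg F j) (@aug_deg F j) (comp_defect F G j).
  have [grFG _ _] := comparisonP j resF resG.
  have [grGF _ _] := comparisonP j resG resF.
  exact: gradedB (gradedM grFG grGF) (@graded1 _ _ _ _).
have defectC j : comp_defect F G j.+1 *m aug_diff F j
    = aug_diff F j *m comp_defect F G j.
  have [_ _ eqFG] := comparisonP j resF resG.
  have [_ _ eqGF] := comparisonP j resG resF.
  by rewrite mulmxBl mulmxBr mul1mx mulmx1 -mulmxA eqGF !mulmxA eqFG.
have step j : graded (@aug_deg F j) (@aug_deg F j.+1) (homotopy F G j) ->
    aug_diff F j *m (comp_defect F G j - homotopy F G j *m aug_diff F j) = 0 ->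
  graded (@aug_deg F j.+1) (@aug_deg F j.+2) (homotopy F G j.+1) /\
  comp_defect F G j.+1 = homotopy F G j.+1 *m aug_diff F j.+1
                         + aug_diff F j *m homotopy F G j.
- move=> gr_h h0; set A := aug_diff F j *m homotopy F G j.
  have [||k|grS eqS] := @chosen_liftP _ _ _ _ _ (@aug_deg F j.+1)
      (@aug_deg F j.+2) (@aug_deg F j.+1) (comp_defect F G j.+1 - A)
      (aug_diff F j.+1).
  + exact: gradedB (@gr_defect _) (gradedM (aug_diff_graded resF) gr_h).
  + exact: aug_diff_graded resF.
  + apply: (rows_in_image resF) k.
    by rewrite mulmxBl defectC -mulmxA -mulmxBr.
  by split=> //=; rewrite eqS subrK.
elim: i => [|i [grS eqS]]; apply: step => //.
- exact: graded0.
- by rewrite /comp_defect /= mul1mx subrr sub0r mul0mx oppr0 mulmx0.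
- by rewrite eqS [X in X - _]addrC addrK mulmxA (aug_diff_comp _ resF) mul0mx.
Qed.

Lemma boundaries_sub_cycles F I i j :
    graded_free_resolution F I ->
  (tensK_boundaries F i j <= tensK_cycles F i j)%MS.
Proof.
move=> resF.
have B_part : (tensK_boundaries F i j <= tensK_part F i j)%MS.
  rewrite /tensK_boundaries /tensK_part.
  by rewrite (deg_projC _ (aug_diff_graded (i := i.+1) resF)) submxMl.
case: i B_part => // i B_part; rewrite sub_capmx B_part; apply/sub_kermxP.
rewrite -mulmxA -map_mxM (aug_diff_comp i.+1 resF).
by rewrite map_mx0 mulmx0.
Qed.

Lemma sub_tensK_part F i j (v : 'rV_(gf_rank F i)) :
  (v <= tensK_part F i j)%MS -> v *m tensK_part F i j = v.
Proof. by move=> /submxP[x ->]; rewrite -mulmxA deg_proj_idem. Qed.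

Lemma comparison_cycles F G I i j (v : 'rV_(gf_rank F i)) :
    graded_free_resolution F I -> graded_free_resolution G I ->
    (v <= tensK_cycles F i j)%MS ->
  (v *m mod_vars (comparison F G i.+1) <= tensK_cycles G i j)%MS.
Proof.
move=> resF resG.
have [_ grFG eqFG] := comparisonP i resF resG.
have f_part : (v <= tensK_part F i j)%MS ->
    (v *m mod_vars (comparison F G i.+1) <= tensK_part G i j)%MS.
  move=> /sub_tensK_part<-.
  by rewrite -mulmxA (deg_projC _ grFG) mulmxA submxMl.
case: i => [|i] in v grFG eqFG f_part *; first exact: f_part.
rewrite !sub_capmx => /andP[/f_part-> /sub_kermxP vd]; apply/sub_kermxP.
have := congr1 (@mod_vars K n _ _) eqFG; rewrite /mod_vars !map_mxM /= => eqK.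
by rewrite -mulmxA eqK mulmxA vd mul0mx.
Qed.

Lemma comparison_boundaries F G I i j :
    graded_free_resolution F I -> graded_free_resolution G I ->
  (tensK_boundaries F i j *m mod_vars (comparison F G i.+1)
     <= tensK_boundaries G i j)%MS.
Proof.
move=> resF resG; have [_ gr eqFG] := comparisonP i.+1 resF resG.
have := congr1 (@mod_vars K n _ _) eqFG; rewrite /mod_vars !map_mxM /= => eqK.
rewrite -mulmxA -eqK mulmxA /tensK_part (deg_projC _ gr) -mulmxA.
exact: submxMl.
Qed.

(** On a cycle v the term v d h of the homotopy vanishes, and v h d is a
    boundary. *)
Lemma comp_defect_cycles F G I i j (v : 'rV_(gf_rank F i)) :
    graded_free_resolution F I -> graded_free_resolution G I ->
    (v <= tensK_cycles F i j)%MS ->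
  (v *m mod_vars (comp_defect F G i.+1) <= tensK_boundaries F i j)%MS.
Proof.
move=> resF resG; have [gr ->] := homotopyP i resF resG.
have h_part : (v <= tensK_part F i j)%MS ->
    (v *m mod_vars (homotopy F G i.+1 *m aug_diff F i.+1)
       <= tensK_boundaries F i j)%MS.
  move=> /sub_tensK_part<-; rewrite /mod_vars map_mxM /= -mulmxA.
  by rewrite [X in (_ *m X)]mulmxA (deg_projC _ gr) -mulmxA mulmxA submxMl.
rewrite /mod_vars map_mxD mulmxDr => vZ; apply: addmx_sub.
  apply: h_part; case: i v vZ {gr} => // i v.
  by rewrite sub_capmx => /andP[].
case: i => [|i] in v gr h_part vZ *.
  by rewrite mulmx0 map_mx0 mulmx0 sub0mx.
move: vZ; rewrite sub_capmx => /andP[_ /sub_kermxP vd].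
by rewrite map_mxM mulmxA vd mul0mx sub0mx.
Qed.

Lemma tor_dim_le F G I i j :
    graded_free_resolution F I -> graded_free_resolution G I ->
  (tor_dim F i j <= tor_dim G i j)%N.
Proof.
move=> resF resG.
apply: (rank_quotient_le (f := mod_vars (comparison F G i.+1))
                         (g := mod_vars (comparison G F i.+1))).
- apply/row_subP => k; rewrite row_mul.
  exact: comparison_cycles resF resG (row_sub _ _).
- exact: comparison_boundaries resG resF.
- exact: boundaries_sub_cycles resG.
apply/row_subP => k; rewrite row_mul.
have := comp_defect_cycles resF resG (row_sub k (tensK_cycles F i j)).
by rewrite /mod_vars map_mxB map_mxM map_mx1.
Qed.

(** Tor does not depend on the resolution: a comparison map F -> G induces an
    embedding in homology modulo the variables, and so does one G -> F. *)
Theorem tor_dim_unique F G I i j :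
    graded_free_resolution F I -> graded_free_resolution G I ->
  tor_dim F i j = tor_dim G i j.
Proof.
by move=> resF resG; apply/eqP; rewrite eqn_leq !(@tor_dim_le _ _ I).
Qed.

End Comparison.

(** * Minimal resolutions *)

Section MinimalResolution.
Variables (K : fieldType) (n : nat).

(** The projection factors as A A^T through the coordinates of degree j, with
    A^T A = 1. *)
Lemma rank_deg_proj s (a : 'I_s -> int) (j : int) :
  \rank (deg_proj K a j) = #|[pred k | a k == j]|.
Proof.
set J := [pred k | _].
pose A : 'M[K]_(s, #|J|) := \matrix_(k, e) (k == enum_val e)%:R.
have AtA : A^T *m A = 1%:M.
  apply/matrixP => e e'; rewrite !mxE (bigD1 (enum_val e)) //= !mxE eqxx mul1r.
  rewrite (inj_eq enum_val_inj) big1 ?addr0 // => k /negPf ke.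
  by rewrite !mxE ke mul0r.
have AAt : deg_proj K a j = A *m A^T.
  apply/matrixP => k l; rewrite !mxE.
  under eq_bigr do rewrite !mxE.
  rewrite -(@big_enum_val _ _ _ _ J (fun x => (k == x)%:R * (l == x)%:R : K)).
  rewrite big_mkcond (bigD1 k) //= eqxx mul1r [l == k]eq_sym.
  rewrite big1 => [|x /negPf]; last first.
    by rewrite eq_sym => ->; rewrite mul0r if_same.
  by rewrite addr0 !inE; case: (a k == j); case: (k == l).
have AtPA : A^T *m deg_proj K a j *m A = 1%:M.
  by rewrite AAt mulmxA AtA mul1mx AtA.
apply/eqP; rewrite eqn_leq {1}AAt.
rewrite (leq_trans (mxrankM_maxr _ _)) ?rank_leq_row //=.
rewrite -[leqLHS](mxrank1 K) -AtPA.
exact: leq_trans (mxrankM_maxl _ _) (mxrankM_maxr _ _).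
Qed.

(** If the differentials vanish modulo the variables, homology is the whole
    complex. *)
Lemma tor_dim_minimal (F : graded_free_seq K n) i j :
    (forall i', tensK_diff F i' = 0) ->
  tor_dim F i j = #|[pred k : 'I_(gf_rank F i) | gf_deg k == j]|.
Proof.
move=> dF0; rewrite /tor_dim /tensK_boundaries dF0 mulmx0 mxrank0 subn0.
rewrite -rank_deg_proj; case: i => //= i.
by rewrite dF0 (cap_eqmx (eqmx_refl _) (kermx0 _ _ _)) capmx1.
Qed.

End MinimalResolution.

Lemma mpolyX_eq0 (K : fieldType) n (v : 'X_{1..n}) :
  ('X_[v] == 0 :> {mpoly K[n]}) = false.
Proof.
apply/eqP => /(congr1 (mcoeff v)); rewrite mcoeffX mcoeff0 eqxx.
exact/eqP/oner_neq0.
Qed.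

(** * The resolution by linear relations *)

Section LinearQuotients.
Variables (K : fieldType) (n m : nat).
(* For k > 0, X^(u k) generates the colon ideal of f_k, and X^(w k), t k witness
   that X^(u k) X^(f k) is a multiple of an earlier generator. *)
Variables (f u w : 'I_m -> 'X_{1..n}) (t : 'I_m -> 'I_m).

Local Notation pos := [pred k : 'I_m | (0 < k)%N].

Hypothesis t_lt : forall k : 'I_m, (0 < k)%N -> (t k < k)%N.
Hypothesis uf_wf : forall k : 'I_m, (0 < k)%N -> (u k + f k = w k + f (t k))%MM.
Hypothesis colon_f : forall (k : 'I_m) (p : {mpoly K[n]}), (0 < k)%N ->
  ideal_gen (fun l : 'I_m => (l < k)%N) (fun l => 'X_[K, f l]) (p * 'X_[f k]) ->
  exists c, p = c * 'X_[u k].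

Definition gens : 'cV[{mpoly K[n]}]_m := \col_k 'X_[f k].

(** The relation X^u f_k = X^w f_(t k). *)
Definition syz_row k : 'rV[{mpoly K[n]}]_m :=
  'X_[u k] *: delta_mx 0 k - 'X_[w k] *: delta_mx 0 (t k).

Definition syz : 'M[{mpoly K[n]}]_(#|pos|, m) :=
  \matrix_e syz_row (enum_val e).

Lemma enum_pos (e : 'I_#|pos|) : (0 < (enum_val e : 'I_m))%N.
Proof. exact: (enum_valP e). Qed.

Lemma syz_rowE k l :
  syz_row k 0 l = 'X_[u k] *+ (l == k) - 'X_[w k] *+ (l == t k).
Proof. by rewrite !mxE /= !mulr_natr. Qed.

Lemma mulmx_gens (v : 'rV_m) : (v *m gens) 0 0 = \sum_k v 0 k * 'X_[f k].
Proof. by rewrite mxE; apply: eq_bigr => k _; rewrite mxE. Qed.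

Lemma syz_row_gens (k : 'I_m) : (0 < k)%N -> syz_row k *m gens = 0.
Proof.
move=> k_gt0; rewrite mulmxBl -!scalemxAl -!rowE; apply/rowP => i.
by rewrite ord1 !mxE -!mpolyXD uf_wf // subrr.
Qed.

Lemma syz_gens : syz *m gens = 0.
Proof.
by apply/row_matrixP => e; rewrite row_mul rowK row0 syz_row_gens ?enum_pos.
Qed.

Lemma syz_row_span (k : 'I_m) c :
  (0 < k)%N -> exists x, c *: syz_row k = x *m syz.
Proof.
move=> k_gt0; exists (c *: delta_mx 0 (enum_rank_in (k_gt0 : k \in pos) k)).
by rewrite -scalemxAl -rowE rowK enum_rankK_in.
Qed.

(** Division along the order of the generators: in a relation supported on the
    first b + 1 generators, the last coefficient lies in a colon ideal (X^u),
    and a multiple of the row of [syz] with leading entry X^u cancels it. *)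
Lemma syz_span_bounded b (v : 'rV_m) :
    (forall k : 'I_m, (b <= k)%N -> v 0 k = 0) -> v *m gens = 0 ->
  exists x, v = x *m syz.
Proof.
elim: b v => [|b IHb] v v0 vg.
  exists 0; rewrite mul0mx; apply/rowP => k; rewrite mxE; exact: v0.
case: (ltnP b m) => [b_m|m_b]; last first.
  by apply: IHb vg => k b_k; have := leq_trans (ltn_ord k) (leq_trans m_b b_k);
    rewrite ltnn.
pose k := Ordinal b_m.
have vk : v 0 k * 'X_[f k] = \sum_(l < m | (l < k)%N) - v 0 l * 'X_[f l].
  have := mulmx_gens v; rewrite vg mxE (bigID (fun l : 'I_m => (l < k)%N)) /=.
  rewrite [X in _ + X](bigD1 k) ?ltnn //= [X in _ + (_ + X)]big1 ?addr0.
    move=> /esym/eqP; rewrite addrC addr_eq0 => /eqP->.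
    by rewrite -sumrN; apply: eq_bigr => l _; rewrite mulNr.
  move=> l /andP[]; rewrite -leqNgt => b_l l_k.
  by rewrite v0 ?mul0r // ltn_neqAle b_l andbT eq_sym.
have [b0|b_gt0] := posnP b.
  apply: IHb vg => l; rewrite b0 leq_eqVlt => /orP[/eqP l0|]; last first.
    by move=> l_gt0; apply: v0; rewrite b0.
  have -> : l = k by apply/val_inj; rewrite /= -l0 b0.
  move/eqP: vk; rewrite big_pred0 => [|i]; last by rewrite /= b0.
  by rewrite mulf_eq0 mpolyX_eq0 orbF => /eqP.
have [|c vkE] := @colon_f k (v 0 k) b_gt0; first by exists (fun l => - v 0 l).
have [x xE] := @syz_row_span k c b_gt0.
have [l||y yE] := IHb (v - c *: syz_row k).
- rewrite mxE [X in _ + X]mxE [X in - X]mxE syz_rowE => b_l.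
  have lt : (l == t k) = false.
    apply/eqP => lt; have := @t_lt k b_gt0.
    by rewrite -lt ltnNge b_l.
  rewrite lt subr0; have [->|l_k] := eqVneq l k; first by rewrite vkE subrr.
  by rewrite v0 ?mulr0 ?subrr // ltn_neqAle b_l andbT eq_sym.
- by rewrite mulmxBl vg -scalemxAl syz_row_gens // scaler0 subrr.
by exists (y + x); rewrite mulmxDl -yE -xE subrK.
Qed.

Lemma syz_exact (v : 'rV_m) : v *m gens = 0 <-> exists x, v = x *m syz.
Proof.
split=> [|[x ->]]; last by rewrite -mulmxA syz_gens mulmx0.
by apply: (@syz_span_bounded m) => k; rewrite leqNgt ltn_ord.
Qed.

(** Among the rows with nonzero coefficient, the one with the largest index is
    the only one that contributes to its leading position. *)
Lemma syz_inj (x : 'rV_#|pos|) : x *m syz = 0 -> x = 0.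
Proof.
move=> x0; apply/eqP; apply: contraT => /rV0Pn[e0 xe0].
have [e xe e_max] : exists2 e, x 0 e != 0
    & forall e', x 0 e' != 0 -> ((enum_val e' : 'I_m) <= (enum_val e : 'I_m))%N.
  case: (@arg_maxnP _ e0 (fun e => x 0 e != 0) (fun e => enum_val e)) => //.
  by move=> e; exists e.
have := congr1 (fun M : 'rV__ => M 0 (enum_val e)) x0.
rewrite !mxE (bigD1 e) //= big1 ?addr0 => [|e' e'e].
  rewrite mxE syz_rowE eqxx; case: eqP => [et|_].
    by have := t_lt (enum_pos e); rewrite -et ltnn.
  by rewrite subr0 => /eqP; rewrite mulf_eq0 mpolyX_eq0 orbF (negPf xe).
have [->|/e_max le] := eqVneq (x 0 e') 0; first by rewrite mul0r.
rewrite mxE syz_rowE (inj_eq enum_val_inj) [e == e']eq_sym (negPf e'e).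
case: eqP => [et|_]; last by rewrite subrr mulr0.
by have := t_lt (enum_pos e'); rewrite -et ltnNge le.
Qed.

Definition quot_rank i := match i with 0 => m | 1 => #|pos| | _ => 0%N end.

Definition quot_deg i : 'I_(quot_rank i) -> int :=
  match i with
  | 0 => fun k => (mdeg (f k))%:Z
  | 1 => fun e => (mdeg (u (enum_val e) + f (enum_val e))%MM)%:Z
  | _ => fun=> 0
  end.

Definition quot_diff i : 'M[{mpoly K[n]}]_(quot_rank i.+1, quot_rank i) :=
  match i with 0 => syz | _ => 0 end.

Definition quot_seq := GradedFreeSeq quot_deg quot_diff gens.

Lemma zhomogX (v : 'X_{1..n}) z : z = (mdeg v)%:Z -> zhomog z 'X_[K, v].
Proof. by move=> ->; rewrite /= dhomogX. Qed.

(** The ordering t k < k makes the matrix of the relations triangular with the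
    nonzero entries X^u on its diagonal, so it is injective and the resolution
    stops in degree 1. *)
Lemma quot_seq_resolution I :
    same_ideal I (ideal_gen predT (fun k => 'X_[K, f k])) ->
  graded_free_resolution quot_seq I.
Proof.
move=> IE; split.
- case=> [|i] k l; last by rewrite mxE zhomog0.
  rewrite /= mxE syz_rowE; have k_gt0 := enum_pos k.
  apply: zhomogB.
    case: eqP => [->|_]; last exact: zhomog0.
    by apply: zhomogX; rewrite mdegD PoszD addrK.
  case: eqP => [->|_]; last exact: zhomog0.
  by apply: zhomogX; rewrite uf_wf // mdegD PoszD addrK.
- by move=> k; rewrite mxE; apply: zhomogX.
- move=> p; rewrite IE; split=> [[c ->]|[v ->]].
    exists (\row_k c k); rewrite mulmx_gens.
    by apply: eq_bigr => k _; rewrite mxE.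
  by exists (v 0); rewrite mulmx_gens.
- exact: syz_exact.
- case=> [|i] v /=.
    split=> [/syz_inj->|[x ->]]; last by rewrite mulmx0 mul0mx.
    by exists 0; rewrite mul0mx.
  by split=> _; [exists 0|]; rewrite ?mulmx0 // thinmx0.
Qed.

Lemma quot_seq_minimal :
    (forall k : 'I_m, (0 < k)%N -> u k != 0%MM /\ w k != 0%MM) ->
  forall i, tensK_diff quot_seq i = 0.
Proof.
move=> uw [|i]; last exact: map_mx0.
apply/matrixP => e l; rewrite [LHS]mxE [X in mcoeff _ X]mxE syz_rowE.
have [/negPf u0 /negPf w0] := uw _ (enum_pos e).
by rewrite mcoeffB !mcoeffMn !mcoeffX u0 w0 !mul0rn subrr mxE.
Qed.

End LinearQuotients.

(** * Monomial generators *)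

Section Monomials.
Variables (K : fieldType) (n : nat) (T : finType) (f : T -> 'X_{1..n}).

(** The coefficient of X^v in a combination of the generators is 1, so some
    summand contains X^v. *)
Lemma ideal_gen_monomial (P : pred T) (v : 'X_{1..n}) :
    ideal_gen P (fun l => 'X_[K, f l]) 'X_[v] ->
  exists l w, P l /\ v = (w + f l)%MM.
Proof.
move=> [c /(congr1 (mcoeff v))]; rewrite mcoeffX eqxx raddf_sum /=.
move=> /esym/eqP sum1.
have [l Pl] : exists2 l, P l & (c l * 'X_[f l])@_v != 0.
  apply/exists_inP; apply: contraTT sum1; rewrite negb_exists_in.
  by move=> /forall_inP c0; rewrite big1 ?[0 == 1]eq_sym ?oner_eq0 // => l Pl;
    apply/eqP/negPn/c0.
rewrite -mcoeff_msupp (perm_mem (msuppMX _ _)) => /mapP[w _ ->].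
by exists l, w; split; rewrite // addmC.
Qed.

Lemma minimal_gens_incomparable I (k l : T) (w : 'X_{1..n}) :
    minimally_generates (fun k => 'X_[K, f k]) I -> k != l ->
  f k = (w + f l)%MM -> False.
Proof.
move=> [_ f_min] kl fk; apply: (f_min k).
exists (fun i => 'X_[w] *+ (i == l)); rewrite (bigD1 l) /=; last first.
  by rewrite eq_sym.
rewrite eqxx -mpolyXD -fk big1 ?addr0 // => i /andP[_ /negPf->].
by rewrite mul0r.
Qed.

End Monomials.

(** * Betti numbers of monomial ideals with linear quotients *)

Unset Implicit Arguments.

Theorem mainTheorem4 (K : fieldType) (n m : nat)
  (I : {mpoly K[n]} -> Prop) (f : 'I_m -> 'X_{1..n}) (d a r : 'I_m -> nat)
  (I_min : minimally_generates (fun k => 'X_[K, f k]) I)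
  (d_deg : forall k, d k = mdeg (f k))
  (I_colon : forall k : 'I_m, (0 < k)%N ->
     exists2 u : 'X_{1..n}, mdeg u = a k &
       same_ideal
         (colon (ideal_gen (fun l : 'I_m => (l < k)%N) (fun l => 'X_[K, f l]))
                'X_[K, f k])
         (principal 'X_[K, u]))
  (r_pos : forall k : 'I_m, (0 < k)%N -> r k = 1%N)
  (a_first : forall k : 'I_m, k = 0%N :> nat -> a k = 0%N)
  (r_first : forall k : 'I_m, k = 0%N :> nat -> r k = 0%N)
  (i j : nat) :
  has_betti I i j%:Z (\sum_(k in index_set a d i j) 'C(r k, i))%N.
Proof.
(* X^u f_k lies in the ideal of the earlier generators, and a monomial in a
   monomial ideal is a multiple of one generator, here X^w f_t. *)
have /fin_all_exists[uwt uwtP] : forall k : 'I_m,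
    exists x : 'X_{1..n} * 'X_{1..n} * 'I_m, (0 < k)%N ->
    [/\ mdeg x.1.1 = a k, (x.2 < k)%N, (x.1.1 + f k = x.1.2 + f x.2)%MM
      & forall p : {mpoly K[n]},
          ideal_gen (fun l : 'I_m => (l < k)%N) (fun l => 'X_[K, f l])
            (p * 'X_[f k]) -> exists c, p = c * 'X_[x.1.1]].
  move=> k; case: (posnP k) => [k0|k_gt0]; first by exists (0%MM, 0%MM, k).
  have [u u_deg colonE] := I_colon k k_gt0.
  have /colonE : principal 'X_[K, u] 'X_[u] by exists 1; rewrite mul1r.
  rewrite /colon -mpolyXD => /ideal_gen_monomial[l [w [l_k uf]]].
  by exists (u, w, l) => _; split=> // p /colonE.
pose u k := (uwt k).1.1; pose w k := (uwt k).1.2; pose t k := (uwt k).2.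
have t_lt (k : 'I_m) : (0 < k)%N -> (t k < k)%N by case/uwtP.
have uf_wf (k : 'I_m) : (0 < k)%N -> (u k + f k = w k + f (t k))%MM.
  by case/uwtP.
have colon_f (k : 'I_m) (p : {mpoly K[n]}) : (0 < k)%N ->
    ideal_gen (fun l : 'I_m => (l < k)%N) (fun l => 'X_[K, f l])
      (p * 'X_[f k]) -> exists c, p = c * 'X_[u k].
  by case/uwtP => _ _ _ colonE /colonE.
(* If X^u or X^w were 1, one of f_k, f_t would divide the other. *)
have uw (k : 'I_m) : (0 < k)%N -> u k != 0%MM /\ w k != 0%MM.
  move=> k_gt0; have tk := t_lt k k_gt0; have ufk := uf_wf k k_gt0.
  have k_t : k != t k by apply: contraTneq tk => <-; rewrite ltnn.
  split; apply/eqP => eq0; move: ufk; rewrite eq0 add0m.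
    exact: (minimal_gens_incomparable I_min k_t).
  by move/esym; apply: (minimal_gens_incomparable I_min); rewrite eq_sym.
have resI := quot_seq_resolution t_lt uf_wf colon_f (proj1 I_min).
split; first by exists (quot_seq K f u w t).
move=> F resF; rewrite (tor_dim_unique i j%:Z resF resI).
rewrite (tor_dim_minimal _ _ (quot_seq_minimal _ _ _ uw)) -sum1_card.
case: i => [|[|i]] /=.
- apply: eq_big => [k|k _]; last by rewrite bin0.
  by rewrite !inE /= muln0 add0n d_deg.
(* The first generator has r = 0 and contributes no relation; any other k gives
   one relation, of degree deg u + deg f_k = a_k + d_k. *)
- rewrite [RHS]big_mkcond (bigID (fun k : 'I_m => (0 < k)%N)) /=.
  rewrite [X in (_ + X)%N]big1 ?addn0 => [|k]; last first.
    by rewrite -eqn0Ngt => /eqP k0; rewrite bin1 r_first // if_same.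
  rewrite [RHS](@big_enum_val _ _ _ _ [pred k : 'I_m | (0 < k)%N]).
  rewrite [LHS]big_mkcond; apply: eq_bigr => e _.
  have k_gt0 := enum_pos e; rewrite !inE bin1 r_pos // muln1 d_deg.
  by rewrite mdegD; case: (uwtP _ k_gt0) => <-.
rewrite big_pred0 => [|[]//]; apply/esym/big1 => k _.
by case: (posnP k) => [/r_first|/r_pos] ->; rewrite bin_small.
Qed.
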